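(* Let $\mathbb{k}$ be an integral domain with unity. Then the quandle ring $\mathbb{k}[\mathrm{Core}(\mathbb{Z})]$ has only trivial idempotents; that is, if $u\in \mathbb{k}[\mathrm{Core}(\mathbb{Z})]$ is non-zero and $u^2=u$, then $u=e_i$ for some $i\in\mathbb{Z}$.
   Context: $\mathrm{Core}(\mathbb{Z})$ is the quandle with underlying set $\mathbb{Z}$ and operation $a*b=2b-a$. The quandle ring $\mathbb{k}[\mathrm{Core}(\mathbb{Z})]$ is the free $\mathbb{k}$-module with basis $\{e_i : i\in\mathbb{Z}\}$ (finite formal sums), with the $\mathbb{k}$-bilinear (in general non-associative) product determined by $e_i e_j=e_{i*j}=e_{2j-i}$. An idempotent is an element $u$ with $u^2=u$; the basis elements $e_i$ are called trivial idempotents. *)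

(* Defs.v *)
From HB Require Import structures.
From mathcomp Require Import all_boot all_algebra finmap.
From mathcomp Require Import ring.
From mathcomp Require Import monalg.

Set Implicit Arguments.
Unset Strict Implicit.
Unset Printing Implicit Defensive.

Import GRing.Theory.

Local Open Scope fset_scope.
Local Open Scope ring_scope.

HB.mixin Record Choice_isQuandle X of Choice X := {
  qop : X -> X -> X;
  qopxx : idempotent_op qop;
  qop_bij : forall y, bijective (qop^~ y);
  qopD : forall x y z, qop (qop x y) z = qop (qop x z) (qop y z)
}.

#[short(type="quandleType")]
HB.structure Definition Quandle := { X of Choice_isQuandle X & Choice X }.

(* An alias of int, so that the quandle structure is attached to Core(Z) only
   and not to int itself. *)
Definition coreZ : Type := int.

HB.instance Definition _ := Choice.on coreZ.

Definition core_op (a b : coreZ) : coreZ := (2 * (b : int) - (a : int) : int).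

Fact core_opxx : idempotent_op core_op.
Proof. by move=> a; rewrite /core_op; ring. Qed.

Fact core_op_bij (b : coreZ) : bijective (core_op^~ b).
Proof. by exists (core_op^~ b) => a; rewrite /core_op; ring. Qed.

Fact core_opD (x y z : coreZ) :
  core_op (core_op x y) z = core_op (core_op x z) (core_op y z).
Proof. by rewrite /core_op; ring. Qed.

HB.instance Definition _ :=
  Choice_isQuandle.Build coreZ core_opxx core_op_bij core_opD.

(* The quandle ring k[X] has carrier {malg k[X]}, the free k-module on X, in
   which << x >> is the basis element e_x and u@_x the coefficient of u at x.
   Its product is not associative and has no unit in general, hence a plain
   function rather than a MathComp ring structure. *)
Section QuandleRing.
Variables (k : comNzRingType) (X : quandleType).
Implicit Types (u v w : {malg k[X]}) (x y : X) (c : k).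

Definition qmul u v : {malg k[X]} :=
  \sum_(x <- msupp u) \sum_(y <- msupp v) (u@_x * v@_y) *: << qop x y >>.

Lemma qmulw (d1 d2 : {fset X}) u v :
  msupp u `<=` d1 -> msupp v `<=` d2 ->
  qmul u v =
    \sum_(x <- d1) \sum_(y <- d2) (u@_x * v@_y) *: << qop x y >>.
Proof.
move=> le1 le2; rewrite /qmul (big_fset_incl _ le1) /=; last first.
  move=> x _ /mcoeff_outdom ->; apply: big1 => y _.
  by rewrite mul0r scale0r.
apply: eq_bigr => x _; apply: big_fset_incl => // y _ /mcoeff_outdom ->.
by rewrite mulr0 scale0r.
Qed.

Lemma qmul_basis x y : qmul << x >> << y >> = << qop x y >>.
Proof.
rewrite (qmulw msuppU_le msuppU_le) !big_seq_fset1 !mcoeffUU mulr1.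
by rewrite scale1r.
Qed.

Lemma qmul_linearl v c u w : qmul (c *: u + w) v = c *: qmul u v + qmul w v.
Proof.
set d := msupp u `|` msupp w `|` msupp (c *: u + w).
have du : msupp u `<=` d by rewrite /d -fsetUA fsubsetUl.
have dw : msupp w `<=` d by rewrite /d fsetUAC fsubsetUr.
have ds : msupp (c *: u + w) `<=` d by rewrite fsubsetUr.
have dv := fsubset_refl (msupp v).
rewrite (qmulw ds dv) (qmulw du dv) (qmulw dw dv) scaler_sumr -big_split /=.
apply: eq_bigr => x _; rewrite scaler_sumr -big_split /=.
apply: eq_bigr => y _.
by rewrite scalerA -scalerDl mcoeffD mcoeffZ mulrDl mulrA.
Qed.

Lemma qmul_linearr v c u w : qmul v (c *: u + w) = c *: qmul v u + qmul v w.
Proof.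
set d := msupp u `|` msupp w `|` msupp (c *: u + w).
have du : msupp u `<=` d by rewrite /d -fsetUA fsubsetUl.
have dw : msupp w `<=` d by rewrite /d fsetUAC fsubsetUr.
have ds : msupp (c *: u + w) `<=` d by rewrite fsubsetUr.
have dv := fsubset_refl (msupp v).
rewrite (qmulw dv ds) (qmulw dv du) (qmulw dv dw) scaler_sumr -big_split /=.
apply: eq_bigr => x _; rewrite scaler_sumr -big_split /=.
apply: eq_bigr => y _.
by rewrite scalerA -scalerDl mcoeffD mcoeffZ mulrDr mulrCA.
Qed.

Lemma qmul_basis_idem x : qmul << x >> << x >> = << x >>.
Proof. by rewrite qmul_basis qopxx. Qed.

End QuandleRing.

(* Main.v *)
Require Import Defs.
From mathcomp Require Import all_boot all_order all_algebra finmap monalg zify.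

(** Identifying e_i with t^i turns k[Core(Z)] into the Laurent polynomials over
    k, with product (p . q)(t) = p(1/t) q(t^2).  Over a domain the width (top
    degree minus bottom degree) of a product of Laurent polynomials is additive,
    and p(1/t), p(t^2) have widths w and 2w when p has width w.  A non-zero
    idempotent therefore has w = 3w, so w = 0 and p = a t^i; finally a^2 = a
    with a <> 0 gives a = 1.

    Concretely, if m and M are the least and greatest elements of the support
    of u, the index 2M - m is reached by the single pair (m, M), so its
    coefficient in u^2 is u_m u_M <> 0 ([mcoeff_qmul_uniq]).  Since u^2 = u,
    this index lies in the support, so 2M - m <= M, whence M <= m. *)

Local Open Scope fset_scope.
Local Open Scope ring_scope.

Import Order.TTheory GRing.Theory.

Lemma mcoeff_qmul (k : comNzRingType) (X : quandleType) (u v : {malg k[X]})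
    (z : X) :
  (qmul u v)@_z =
    \sum_(x <- msupp u) \sum_(y <- msupp v)
      (u@_x * v@_y) *+ (qop x y == z).
Proof.
rewrite /qmul raddf_sum; apply: eq_bigr => x _.
rewrite raddf_sum; apply: eq_bigr => y _.
by rewrite /= mcoeffZ mcoeffU mulr_natr.
Qed.

(** The quandle counterpart of the unique-product argument of group rings: no
    cancellation can occur at an index reached by a single pair of the
    supports. *)
Lemma mcoeff_qmul_uniq (k : comNzRingType) (X : quandleType)
    (u v : {malg k[X]}) (a b : X) :
    a \in msupp u -> b \in msupp v ->
    (forall x y, x \in msupp u -> y \in msupp v ->
       qop x y = qop a b -> x = a /\ y = b) ->
  (qmul u v)@_(qop a b) = u@_a * v@_b.
Proof.
move=> ua vb uniq_ab; rewrite mcoeff_qmul.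
rewrite (big_fsetD1 a ua) /= (big_fsetD1 b vb) /= eqxx mulr1n.
rewrite [X in _ + X + _]big1_seq ?[X in _ + X]big1_seq ?addr0 //.
- move=> x /andP[_]; rewrite in_fsetD1 => /andP[xa ux].
  apply: big1_seq => y /andP[_ vy].
  case: eqP => [/(uniq_ab _ _ ux vy)[eq_xa _]|_]; last by rewrite mulr0n.
  by rewrite eq_xa eqxx in xa.
- move=> y /andP[_]; rewrite in_fsetD1 => /andP[yb vy].
  case: eqP => [/(uniq_ab _ _ ua vy)[_ eq_yb]|_]; last by rewrite mulr0n.
  by rewrite eq_yb eqxx in yb.
Qed.

Lemma fset_coreZ_extrema (A : {fset coreZ}) :
  A != fset0 -> exists m M : coreZ,
    [/\ m \in A, M \in A
      & forall x : coreZ, x \in A -> (m : int) <= x /\ (x : int) <= M].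
Proof.
case/fset0Pn=> x0 Ax0; pose f (x : A) : int := val x.
case: (arg_minP f (i0 := [` Ax0]) (P := predT)) => // m _ min_m.
case: (arg_maxP f (i0 := [` Ax0]) (P := predT)) => // M _ max_M.
exists (val m), (val M); split; [exact: valP | exact: valP |] => x Ax.
by split; [apply: (min_m [` Ax]) | apply: (max_M [` Ax])].
Qed.

Theorem theorem3p1 (k : idomainType) (u : {malg k[coreZ]}) :
  u != 0 -> qmul u u = u -> exists i : coreZ, u = << i >>.
Proof.
move=> u_neq0 u_idem.
have supp_neq0 : msupp u != fset0.
  apply: contraNneq u_neq0 => supp0; apply/eqP/malgP => x.
  by rewrite mcoeff0 mcoeff_outdom // supp0 in_fset0.
have [m [M [um uM u_bnd]]] := fset_coreZ_extrema _ supp_neq0.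
have coef_mM : (qmul u u)@_(qop m M) = u@_m * u@_M.
  apply: mcoeff_qmul_uniq => // x y /u_bnd[mx _] /u_bnd[_ yM].
  rewrite /qop /= /core_op => eq_xy.
  (* the equation says 2 (M - y) + (x - m) = 0, with both terms nonnegative *)
  by split; lia.
have leMm : (M : int) <= m.
  have : qop m M \in msupp u.
    by rewrite -mcoeff_neq0 -u_idem coef_mM mulf_neq0 // mcoeff_neq0.
  by case/u_bnd=> _; rewrite /qop /= /core_op; lia.
have supp_m x : x \in msupp u -> x = m by case/u_bnd => *; lia.
have coef_mm : u@_m = u@_m * u@_m.
  have := @mcoeff_qmul_uniq _ _ u u m m um um.
  by rewrite u_idem qopxx; apply=> x y /supp_m-> /supp_m->.
have um1 : u@_m = 1.
  have um0 : u@_m != 0 by rewrite mcoeff_neq0.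
  by apply: (mulfI um0); rewrite -coef_mm mulr1.
exists m; apply/malgP => x; rewrite mcoeffU.
have [<-|neq_mx] := eqVneq m x; first by rewrite um1.
by apply: mcoeff_outdom; apply: contraNN neq_mx => /supp_m->.
Qed.
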